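(* For a strategy profile $\boldsymbol{g}$ let $\mathcal{J}_T(\boldsymbol{g})=\mathbb{E}^{\boldsymbol{g}}[c_T(X_T,U_T^1,U_T^2)]$, and let $$J_T^1(\pi_T^1,u_T^2)=\inf_{u_T^1\in\mathcal{U}_T^1}\tilde c_T^1(\pi_T^1,u_T^1,u_T^2),$$ with $g_T^{*1}(\pi_T^1,u_T^2)$ denoting a minimizer $u_T^1$ on the right-hand side. 1) For all $\boldsymbol{g}\in\mathcal{G}''$, $\mathcal{J}_T(\boldsymbol{g})\ge\mathbb{E}^{\boldsymbol{g}}[J_T^1(\Pi_T^1,U_T^2)]$. 2) For all $\boldsymbol{g}\in\mathcal{G}''$, $\mathcal{J}_T(\boldsymbol{g}_{0:T-1},g_T^{*1},g_T^2)=\mathbb{E}^{\boldsymbol{g}}[J_T^1(\Pi_T^1,U_T^2)]$, where $\boldsymbol{g}_{0:T-1}$ are the laws of $\boldsymbol{g}$ at times $0,\dots,T-1$ and $g_T^2$ is the law of agent 2 in $\boldsymbol g$ at time $T$.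
   Context: Team model. Fix $T\in\mathbb{N}$; time runs over $t=0,\dots,T$. The state $X_t$ takes values in a finite set $\mathcal{X}_t$. Agents $k\in\{1,2\}$ choose actions $U_t^k$ in finite sets $\mathcal{U}_t^k$ and receive observations $Y_t^k$ in finite sets $\mathcal{Y}_t^k$. The dynamics are $X_{t+1}=f_t(X_t,U_t^1,U_t^2,W_t)$ for $t=0,\dots,T-1$, and $Y_t^k=h_t^k(X_t,V_t^k)$ for $t=0,\dots,T$, where the disturbances $W_t$ and noises $V_t^k$ take values in finite sets. The primitive random variables $X_0$, $W_t$, $V_t^1$, $V_t^2$ ($t=0,\dots,T$) are mutually independent with known distributions. The cost functions are $c_t:\mathcal{X}_t\times\mathcal{U}_t^1\times\mathcal{U}_t^2\to\mathbb{R}_{\ge 0}$. Memories. $M_t^2=\{Y_{0:t}^2,U_{0:t-1}^2\}$, $M_t^1=\{Y_{0:t}^1,U_{0:t-1}^1,Y_{0:t}^2,U_{0:t-1}^2\}$, and $L_t^{[1,2]}=M_t^1\setminus M_t^2=\{Y_{0:t}^1,U_{0:t-1}^1\}$ with finite set of possible values $\mathcal{L}_t^{[1,2]}$. Information states. $\Pi_t^1=\mathbb{P}^{\boldsymbol g}(X_t\mid M_t^1)\in\mathcal{P}_t^1=\Delta(\mathcal{X}_t)$ and $\Pi_t^2=\mathbb{P}^{\boldsymbol g}(X_t,L_t^{[1,2]}\mid M_t^2)\in\mathcal{P}_t^2=\Delta(\mathcal{X}_t\times\mathcal{L}_t^{[1,2]})$ under the strategy profile in use (additionally conditioning $\Pi_t^2$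 on past prescriptions, which are functions of $M_t^2$, changes nothing). Strategies. $\mathcal{G}''$ is the set of strategy profiles $\boldsymbol{g}=(g_t^1,g_t^2)_{t=0}^T$ of the form $U_t^1=g_t^1(\Pi_t^1,\Pi_t^2)$, $U_t^2=g_t^2(\Pi_t^2)$. At time $T$, agent 1 may also use $U_T^2$, i.e. a law $\bar g_T^1(\Pi_T^1,\Pi_T^2,U_T^2)$; given $U_T^2=g_T^2(\Pi_T^2)$ this is the same as the law $(\pi^1,\pi^2)\mapsto\bar g_T^1(\pi^1,\pi^2,g_T^2(\pi^2))$, so such laws are also denoted $g_T^1$. In particular $g_T^{*1}$ is used as $U_T^1=g_T^{*1}(\Pi_T^1,U_T^2)$. Expected cost: $\tilde c_T^1(\pi^1,u^1,u^2)=\sum_{x\in\mathcal{X}_T}\pi^1(x)\,c_T(x,u^1,u^2)$. *)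

(* Defs.v *)
From HB Require Import structures.
From mathcomp Require Import all_boot all_order all_algebra.
From mathcomp Require Import all_classical all_reals all_analysis.
Set Implicit Arguments.
Unset Strict Implicit.
Unset Printing Implicit Defensive.
Import Order.TTheory GRing.Theory Num.Theory.
Local Open Scope classical_set_scope.
Local Open Scope ring_scope.

(* The simplex Delta(A). *)
Record fdist (R : realType) (A : finType) := FDist {
  fdist_fun :> {ffun A -> R};
  fdist_axiom : (forall a, 0 <= fdist_fun a) /\ \sum_a fdist_fun a = 1 }.

(* Random variables with values in a finite set that carries the discrete
   sigma-algebra. *)
Record frv d (Omega : measurableType d) (A : finType) := FRV {
  frv_fun :> Omega -> A;
  frv_measurable : forall a, measurable (frv_fun @^-1` [set a]) }.

Section FiniteRandomVariables.
Context d (Omega : measurableType d).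

Lemma frv_map_measurable (A B : finType) (h : A -> B) (Z : frv Omega A) b :
  measurable ((fun w => h (Z w)) @^-1` [set b]).
Proof.
have -> : (fun w => h (Z w)) @^-1` [set b] =
    \bigcup_(a in h @^-1` [set b]) (Z @^-1` [set a]).
  apply/seteqP; split=> w /=.
    by move=> hb; exists (Z w).
  by case=> a /= hb ->.
apply: fin_bigcup_measurable; first exact: finite_finset.
by move=> a _; exact: frv_measurable.
Qed.

Definition frv_map (A B : finType) (h : A -> B) (Z : frv Omega A) :
  frv Omega B := FRV (frv_map_measurable h Z).

Lemma frv_pair_measurable (A B : finType) (Z1 : frv Omega A)
    (Z2 : frv Omega B) ab :
  measurable ((fun w => (Z1 w, Z2 w)) @^-1` [set ab]).
Proof.
have -> : (fun w => (Z1 w, Z2 w)) @^-1` [set ab] =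
    (Z1 @^-1` [set ab.1]) `&` (Z2 @^-1` [set ab.2]).
  case: ab => a b; apply/seteqP; split=> w /=; first by case=> -> ->.
  by case=> -> ->.
by apply: measurableI; exact: frv_measurable.
Qed.

Definition frv_pair (A B : finType) (Z1 : frv Omega A) (Z2 : frv Omega B) :
  frv Omega (A * B)%type := FRV (frv_pair_measurable Z1 Z2).

Context (R : realType) (P : probability Omega R).

Definition frv_prob (A : finType) (Z : frv Omega A) (a : A) : R :=
  fine (P (Z @^-1` [set a])).

Lemma frv_prob_ge0 (A : finType) (Z : frv Omega A) a : 0 <= frv_prob Z a.
Proof. by apply: fine_ge0; exact: measure_ge0. Qed.

Lemma frv_prob_EFin (A : finType) (Z : frv Omega A) a :
  (frv_prob Z a)%:E = P (Z @^-1` [set a]).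
Proof.
by rewrite /frv_prob fineK//; apply: fin_num_measure; exact: frv_measurable.
Qed.

Lemma bigcup_frv (A : finType) (Z : frv Omega A) (E : A -> set Omega) :
  (forall a, measurable (E a)) -> (forall a, E a `<=` Z @^-1` [set a]) ->
  (\sum_a P (E a))%E = P (\bigcup_a E a).
Proof.
move=> mE EZ.
have -> : [set: A] = [set` index_enum A].
  by apply/seteqP; split=> a //= _; exact: mem_index_enum.
have fA (D : set A) : finite_set D by exact: finite_finset.
rewrite measure_fin_bigcup//.
  by rewrite [LHS]fsbig_seq//; exact: index_enum_uniq.
by move=> i j _ _ [w [/EZ <- /EZ <-]].
Qed.

Lemma frv_prob_pair_sum (A B : finType) (Z : frv Omega A) (M : frv Omega B) b :
  \sum_a frv_prob (frv_pair Z M) (a, b) = frv_prob M b.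
Proof.
apply: EFin_inj; rewrite frv_prob_EFin -sumEFin.
under eq_bigr do rewrite frv_prob_EFin.
rewrite (bigcup_frv (Z := Z)).
- congr (P _); apply/seteqP; split=> w /=; first by case=> a _ /= [_ ->].
  by move=> <-; exists (Z w).
- by move=> a; exact: (frv_measurable (frv_pair Z M)).
- by move=> a w /= [].
Qed.

Lemma frv_prob_sum (A : finType) (Z : frv Omega A) :
  \sum_a frv_prob Z a = 1.
Proof.
apply: EFin_inj; rewrite -sumEFin.
under eq_bigr do rewrite frv_prob_EFin.
rewrite (@bigcup_frv _ Z (fun a => Z @^-1` [set a]) (frv_measurable Z))//;
  last by move=> a w.
rewrite -(@probability_setT _ _ _ P); congr (P _).
by apply/seteqP; split=> w //= _; exists (Z w).
Qed.

Definition cond_fun (A B : finType) (Z : frv Omega A) (M : frv Omega B)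
    (b : B) : {ffun A -> R} :=
  if frv_prob M b == 0 then [ffun a => frv_prob Z a]
  else [ffun a => frv_prob (frv_pair Z M) (a, b) / frv_prob M b].

Lemma cond_funP (A B : finType) (Z : frv Omega A) (M : frv Omega B) b :
  (forall a, 0 <= cond_fun Z M b a) /\ \sum_a cond_fun Z M b a = 1.
Proof.
rewrite /cond_fun; case: eqP => [_|/eqP Mb0]; split.
- by move=> a; rewrite ffunE frv_prob_ge0.
- by under eq_bigr do rewrite ffunE; exact: frv_prob_sum.
- by move=> a; rewrite ffunE divr_ge0// frv_prob_ge0.
- under eq_bigr do rewrite ffunE.
  by rewrite -mulr_suml frv_prob_pair_sum divff.
Qed.

(* The conditional distribution P(Z = . | M = b).  On the null event
   P(M = b) = 0 any version may be chosen; the law of Z is used so that the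
   value is always a point of the simplex. *)
Definition cond_dist (A B : finType) (Z : frv Omega A) (M : frv Omega B)
  (b : B) : fdist R A := FDist (cond_funP Z M b).

Definition mutually_independent (I : finType) (S : I -> finType)
    (Z : forall i, frv Omega (S i)) : Prop :=
  forall (J : {set I}) (E : forall i, {set S i}),
    fine (P (\bigcap_(i in [set` J]) (Z i @^-1` [set` E i]))) =
    \prod_(i in J) fine (P (Z i @^-1` [set` E i])).

End FiniteRandomVariables.

(* The data are families indexed by all of nat, but only the times
   0, ..., horizon are ever constrained or used. *)
Record team (R : realType) := Team {
  horizon : nat;
  state : nat -> finType;
  action1 : nat -> finType;
  action2 : nat -> finType;
  obs1 : nat -> finType;
  obs2 : nat -> finType;
  disturbance : nat -> finType;
  noise1 : nat -> finType;
  noise2 : nat -> finType;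
  dynamics : forall t, state t -> action1 t -> action2 t -> disturbance t ->
    state t.+1;
  observe1 : forall t, state t -> noise1 t -> obs1 t;
  observe2 : forall t, state t -> noise2 t -> obs2 t;
  cost : forall t, state t -> action1 t -> action2 t -> R;
  cost_ge0 : forall t x u1 u2, (t <= horizon)%N -> 0 <= @cost t x u1 u2 }.

(* (Y_{0:t}, U_{0:t-1}), nested as (((Y_0, U_0), Y_1), U_1), ..., Y_t. *)
Fixpoint history (Y U : nat -> finType) (t : nat) : finType :=
  if t is s.+1 then (history Y U s * U s * Y s.+1)%type : finType else Y 0%N.

Section Primitives.
Context (R : realType) (m : team R).

Definition primitive_index : finType :=
  (unit + ('I_(horizon m).+1 + ('I_(horizon m).+1 + 'I_(horizon m).+1)))%type.

Definition primitive_range (i : primitive_index) : finType :=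
  match i with
  | inl _ => state m 0
  | inr (inl t) => disturbance m t
  | inr (inr (inl t)) => noise1 m t
  | inr (inr (inr t)) => noise2 m t
  end.

Context d (Omega : measurableType d).

Definition primitive_family (X0 : frv Omega (state m 0))
    (W : forall t, frv Omega (disturbance m t))
    (V1 : forall t, frv Omega (noise1 m t))
    (V2 : forall t, frv Omega (noise2 m t)) (i : primitive_index) :
    frv Omega (primitive_range i) :=
  match i with
  | inl _ => X0
  | inr (inl t) => W t
  | inr (inr (inl t)) => V1 t
  | inr (inr (inr t)) => V2 t
  end.

Record primitives (P : probability Omega R) := Primitives {
  init : frv Omega (state m 0);
  disturbance_rv : forall t, frv Omega (disturbance m t);
  noise1_rv : forall t, frv Omega (noise1 m t);
  noise2_rv : forall t, frv Omega (noise2 m t);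
  primitives_indep : mutually_independent P
    (primitive_family init disturbance_rv noise1_rv noise2_rv) }.

End Primitives.

Section Team.
Context (R : realType) (m : team R).

Definition private1 (t : nat) : finType := history (obs1 m) (action1 m) t.
Definition memory2 (t : nat) : finType := history (obs2 m) (action2 m) t.
Definition memory1 (t : nat) : finType := (private1 t * memory2 t)%type.

Definition info_space1 (t : nat) := fdist R (state m t).
Definition info_space2 (t : nat) := fdist R (state m t * private1 t)%type.

Record profile := Profile {
  law1 : forall t, info_space1 t -> info_space2 t -> action1 m t;
  law2 : forall t, info_space2 t -> action2 m t }.

(* (g_{0:T-1}, gbar_T^1, g_T^2), where T is the horizon and the law gbar of
   agent 1 uses (Pi_T^1, U_T^2): by U_T^2 = g_T^2(Pi_T^2) it is the law
   (pi1, pi2) |-> gbar(pi1, g_T^2(pi2)). *)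
Definition replace_last1 (g : profile)
    (gbar : info_space1 (horizon m) -> action2 m (horizon m) ->
            action1 m (horizon m)) : profile :=
  Profile
    (@dfwith nat (fun t => info_space1 t -> info_space2 t -> action1 m t) (@law1 g)
       (horizon m) (fun pi1 pi2 => gbar pi1 (law2 g pi2)))
    (@law2 g).

Definition expected_cost (pi : info_space1 (horizon m))
    (u1 : action1 m (horizon m)) (u2 : action2 m (horizon m)) : R :=
  \sum_x pi x * cost x u1 u2.

Definition J1 (pi : info_space1 (horizon m)) (u2 : action2 m (horizon m)) : R :=
  inf [set expected_cost pi u1 u2 | u1 in [set: action1 m (horizon m)]].

Context d (Omega : measurableType d) (P : probability Omega R)
  (prim : primitives m P).

(* Closed loop at time t: the random variable S = (X_t, L_t, M_t^2). *)
Definition snapshot (t : nat) := frv Omega (state m t * private1 t * memory2 t)%type.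

Section Snapshot.
Context (g : profile) (t : nat) (S : snapshot t).

Definition state_of : frv Omega (state m t) := frv_map (fun s => s.1.1) S.
Definition private1_of : frv Omega (private1 t) := frv_map (fun s => s.1.2) S.
Definition memory2_of : frv Omega (memory2 t) := frv_map (fun s => s.2) S.
Definition memory1_of : frv Omega (memory1 t) :=
  frv_pair private1_of memory2_of.

Definition belief1 (m1 : memory1 t) : info_space1 t :=
  cond_dist P state_of memory1_of m1.
Definition belief2 (m2 : memory2 t) : info_space2 t :=
  cond_dist P (frv_pair state_of private1_of) memory2_of m2.

Definition action1_of : frv Omega (action1 m t) :=
  frv_map (fun m1 : memory1 t => law1 g (belief1 m1) (belief2 m1.2)) memory1_of.
Definition action2_of : frv Omega (action2 m t) :=
  frv_map (fun m2 => law2 g (belief2 m2)) memory2_of.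

Definition step (s : state m t * private1 t * memory2 t)
    (u : action1 m t * action2 m t)
    (n : disturbance m t * (noise1 m t.+1 * noise2 m t.+1)) :
    (state m t.+1 * private1 t.+1 * memory2 t.+1)%type :=
  let x := dynamics s.1.1 u.1 u.2 n.1 in
  (x, (s.1.2, u.1, observe1 x n.2.1), (s.2, u.2, observe2 x n.2.2)).

Definition next_snapshot : snapshot t.+1 :=
  frv_map (fun z => step z.1 z.2.1 z.2.2)
    (frv_pair S (frv_pair (frv_pair action1_of action2_of)
      (frv_pair (disturbance_rv prim t)
        (frv_pair (noise1_rv prim t.+1) (noise2_rv prim t.+1))))).

End Snapshot.

Definition first_snapshot : snapshot 0 :=
  frv_map (fun z => (z.1, observe1 z.1 z.2.1, observe2 z.1 z.2.2))
    (frv_pair (init prim) (frv_pair (noise1_rv prim 0) (noise2_rv prim 0))).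

Fixpoint closed_loop (g : profile) (t : nat) : snapshot t :=
  if t is s.+1 then next_snapshot g (closed_loop g s) else first_snapshot.

Section Processes.
Context (g : profile) (t : nat).

Definition Xproc : Omega -> state m t := state_of (closed_loop g t).
Definition U1proc : Omega -> action1 m t := action1_of g (closed_loop g t).
Definition U2proc : Omega -> action2 m t := action2_of g (closed_loop g t).
Definition Pi1proc (w : Omega) : info_space1 t :=
  belief1 (closed_loop g t) (memory1_of (closed_loop g t) w).
Definition Pi2proc (w : Omega) : info_space2 t :=
  belief2 (closed_loop g t) (memory2_of (closed_loop g t) w).

End Processes.

Lemma XprocS g t w :
  Xproc g t.+1 w = dynamics (Xproc g t w) (U1proc g t w) (U2proc g t w)
                     (disturbance_rv prim t w).
Proof. by []. Qed.

Lemma U1procE g t w : U1proc g t w = law1 g (Pi1proc g t w) (Pi2proc g t w).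
Proof. by []. Qed.

Lemma U2procE g t w : U2proc g t w = law2 g (Pi2proc g t w).
Proof. by []. Qed.

Lemma private1S g t w :
  private1_of (closed_loop g t.+1) w =
  (private1_of (closed_loop g t) w, U1proc g t w,
   observe1 (Xproc g t.+1 w) (noise1_rv prim t.+1 w)).
Proof. by []. Qed.

Lemma memory2S g t w :
  memory2_of (closed_loop g t.+1) w =
  (memory2_of (closed_loop g t) w, U2proc g t w,
   observe2 (Xproc g t.+1 w) (noise2_rv prim t.+1 w)).
Proof. by []. Qed.

Definition terminal_cost (g : profile) : \bar R :=
  'E_P[fun w => cost (Xproc g (horizon m) w) (U1proc g (horizon m) w)
                     (U2proc g (horizon m) w)].

End Team.

(* Main.v *)
Require Import Defs.
From mathcomp Require Import all_boot all_order all_algebra.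
From mathcomp Require Import all_classical all_reals all_analysis.
Import Order.TTheory GRing.Theory Num.Theory.
Local Open Scope ring_scope.

(** Agent 1 knows everything that agent 2 knows, so at the last time both
    actions are functions of the memory of agent 1.  Conditioning the terminal
    cost on that memory therefore averages it over the state only, with weights
    [Pi1], and leaves the actions alone (tower property, [expectation_cond]):
    the terminal cost of any profile is the expectation of
    [expected_cost Pi1 U1 U2] ([terminal_cost_conditioned]).

    Pointwise this integrand is at least [J1 Pi1 U2], which is an infimum over
    the value of [U1]; this is the first claim.  For the second one, a minimizer
    turns the inequality into an equality, and changing a law at the last time
    only does not change the closed loop up to that time
    ([closed_loop_replace_last1]): the memories, hence the beliefs and the
    action of agent 2, are the same under both profiles. *)

Section Expectation.
Context {R : realType} {d : measure_display} {Omega : measurableType d}.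
Context {P : probability Omega R}.

Lemma expectation_frv {A : finType} (Z : frv Omega A) (f : A -> R) :
  'E_P[fun w => f (Z w)]%E = (\sum_a frv_prob P Z a * f a)%:E.
Proof.
have f_simple w :
    (f (Z w))%:E = (\sum_a (f a)%:E * (\1_(Z @^-1` [set a])%classic w)%:E)%E.
  rewrite (bigD1 (Z w))//= big1 => [|a aZ].
    by rewrite indicE mem_set// mule1 adde0.
  by rewrite indicE memNset ?mule0//= => Za; rewrite Za eqxx in aZ.
have int_indic a :
    P.-integrable [set: Omega] (fun w => (\1_(Z @^-1` [set a])%classic w)%:E).
  exact/integrable_indic/frv_measurable.
rewrite unlock; under eq_integral do rewrite f_simple.
rewrite integral_sum//; last by move=> a; exact: integrableZl.
rewrite -sumEFin; apply: eq_bigr => a _.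
rewrite integralZl// integral_indic//; last exact: frv_measurable.
by rewrite setIT EFinM frv_prob_EFin muleC.
Qed.

Lemma expectation_frv_le {A : finType} (Z : frv Omega A) (f h : A -> R) :
  (forall a, f a <= h a) ->
  ('E_P[fun w => f (Z w)] <= 'E_P[fun w => h (Z w)])%E.
Proof.
move=> fh; rewrite !expectation_frv lee_fin; apply: ler_sum => a _.
by rewrite ler_wpM2l ?frv_prob_ge0.
Qed.

(** On a null event of [M] the joint probabilities vanish as well, so the
    identity holds for whichever version of the conditional distribution. *)
Lemma frv_prob_cond {A B : finType} (Z : frv Omega A) (M : frv Omega B) a b :
  frv_prob P M b * cond_dist P Z M b a = frv_prob P (frv_pair Z M) (a, b).
Proof.
rewrite /= /cond_fun; case: eqP => [M0|/eqP M0]; rewrite ffunE; last first.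
  by rewrite mulrC divfK.
have /psumr_eq0P joint0 := etrans (frv_prob_pair_sum P Z M b) M0.
by rewrite M0 mul0r joint0// => i _; exact: frv_prob_ge0.
Qed.

(** Tower property, for an integrand whose dependence on [M] is frozen by the
    conditioning. *)
Lemma expectation_cond {A B : finType} (Z : frv Omega A) (M : frv Omega B)
    (f : A -> B -> R) :
  'E_P[fun w => f (Z w) (M w)]%E =
  'E_P[fun w => (\sum_a cond_dist P Z M (M w) a * f a (M w))%R]%E.
Proof.
rewrite (expectation_frv (frv_pair Z M) (fun ab => f ab.1 ab.2)).
rewrite (expectation_frv M (fun b => \sum_a cond_dist P Z M b a * f a b)).
congr (_%:E); under [RHS]eq_bigr do rewrite mulr_sumr.
rewrite exchange_big pair_big; apply: eq_bigr => -[a b] _ /=.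
by rewrite mulrA frv_prob_cond.
Qed.

End Expectation.

Section MinimalCost.
Context {R : realType} {m : team R}.
Implicit Types (pi : info_space1 m (horizon m)) (u : action2 m (horizon m)).

(** Costs are nonnegative, so the set is bounded below and [inf] is its actual
    greatest lower bound, not the default value. *)
Lemma J1_le pi u v : J1 pi u <= expected_cost pi v u.
Proof.
apply: ge_inf; last by exists v.
exists 0 => _ [v' _ <-]; apply: sumr_ge0 => x _.
by rewrite mulr_ge0 ?cost_ge0//; case: (fdist_axiom pi).
Qed.

Lemma J1_min pi u v :
  (forall v', expected_cost pi v u <= expected_cost pi v' u) ->
  J1 pi u = expected_cost pi v u.
Proof.
move=> v_min; apply/eqP; rewrite eq_le J1_le /=.
apply: lb_le_inf; first by exists (expected_cost pi v u), v.
by move=> _ [v' _ <-].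
Qed.

End MinimalCost.

Section ClosedLoop.
Context {R : realType} {m : team R}.
Context {d : measure_display} {Omega : measurableType d}.
Context {P : probability Omega R} {prim : primitives m P}.

(** Both actions are functions of the memory of agent 1, so conditioning on it
    averages over the state alone, with weights [Pi1proc]. *)
Lemma terminal_cost_conditioned (g : profile m) :
  terminal_cost prim g =
  'E_P[fun w => expected_cost (Pi1proc prim g (horizon m) w)
                  (U1proc prim g (horizon m) w)
                  (U2proc prim g (horizon m) w)]%E.
Proof.
pose S := closed_loop prim g (horizon m).
exact: (expectation_cond (state_of S) (memory1_of S)
  (fun x m1 => cost x (law1 g (belief1 P S m1) (belief2 P S m1.2))
                      (law2 g (belief2 P S m1.2)))).
Qed.

(** Causality: the snapshot at time [t], its beliefs included, is produced by
    the laws used strictly before [t]. *)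
Lemma eq_closed_loop (g h : profile m) t :
  (forall s, (s < t)%N -> @law1 _ _ g s = @law1 _ _ h s) ->
  (forall s, (s < t)%N -> @law2 _ _ g s = @law2 _ _ h s) ->
  closed_loop prim g t = closed_loop prim h t.
Proof.
elim: t => [//|t IH] eq1 eq2 /=.
rewrite IH; [|by move=> s /ltnW; exact: eq1|by move=> s /ltnW; exact: eq2].
by rewrite /next_snapshot /action1_of /action2_of eq1 ?eq2.
Qed.

Lemma closed_loop_replace_last1 (g : profile m) gbar :
  closed_loop prim (replace_last1 g gbar) (horizon m) =
  closed_loop prim g (horizon m).
Proof.
apply: eq_closed_loop => //= s s_lt; rewrite dfwithout//.
by rewrite gtn_eqF.
Qed.

End ClosedLoop.

Theorem lemma10 (R : realType) (m : team R)
    (d : measure_display) (Omega : measurableType d)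
    (P : probability Omega R) (prim : primitives m P) :
  (forall g : profile m,
     (terminal_cost prim g >=
      'E_P[fun w => J1 (Pi1proc prim g (horizon m) w)
                       (U2proc prim g (horizon m) w)])%E) /\
  (forall gstar : info_space1 m (horizon m) -> action2 m (horizon m) ->
                  action1 m (horizon m),
     (forall pi u2 u1,
        expected_cost pi (gstar pi u2) u2 <= expected_cost pi u1 u2) ->
     forall g : profile m,
       terminal_cost prim (replace_last1 g gstar) =
       'E_P[fun w => J1 (Pi1proc prim g (horizon m) w)
                        (U2proc prim g (horizon m) w)]%E).
Proof.
split=> [g|gstar gstar_min g].
  rewrite terminal_cost_conditioned.
  pose S := closed_loop prim g (horizon m).
  (* Both integrands are functions of the memory of agent 1, so the pointwise
     inequality is only required at each of its finitely many values. *)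
  pose u2 (m1 : memory1 m (horizon m)) := law2 g (belief2 P S m1.2).
  apply: (expectation_frv_le (memory1_of S)
    (fun m1 => J1 (belief1 P S m1) (u2 m1))
    (fun m1 => expected_cost (belief1 P S m1)
       (law1 g (belief1 P S m1) (belief2 P S m1.2)) (u2 m1))) => m1.
  exact: J1_le.
rewrite terminal_cost_conditioned; congr expectation; apply/funext => w.
(* Once the closed loops agree, only the law of agent 1 at the last time
   differs, and it is [gstar] composed with the law of agent 2. *)
rewrite U1procE !U2procE /Pi1proc /Pi2proc closed_loop_replace_last1 /=.
by rewrite dfwithin; apply/esym/J1_min => u1.
Qed.
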